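(* Let $G$ be a group of order $4p$ or $pq$ for some primes $p$ and $q$, and let $H$ be a nontrivial subgroup of $G$. Then: (a) $H$ is a perfect code of $G$ if and only if $H$ is an $(a,b)$-regular set of $G$ for every pair of integers $a,b$ with $0\leqslant a\leqslant |H|-1$, $0\leqslant b\leqslant |H|$, and $a$ even when $|H|$ is odd; (b) $H$ is a total perfect code of $G$ if and only if $H$ is an $(a,b)$-regular set of $G$ for every pair of integers $a,b$ with $0\leqslant a\leqslant |H|-1$ and $0\leqslant b\leqslant |H|$.
   Context: All groups are finite and all graphs are finite, undirected and simple; $e$ denotes the identity. For a group $G$ and an inverse-closed subset $S\subseteq G\setminus\{e\}$, the Cayley graph $\mathrm{Cay}(G,S)$ has vertex set $G$, with $x,y$ adjacent iff $yx^{-1}\in S$. For a graph $\Gamma$ with vertex set $V$ and nonnegative integers $a,b$, an $(a,b)$-regular set in $\Gamma$ is a nonempty proper subset $C\subset V$ such that every vertex of $C$ has exactly $a$ neighbours in $C$ and every vertex of $V\setminus C$ has exactly $b$ neighbours in $C$. A $(0,1)$-regular set is a perfect code and a $(1,1)$-regular set is a total perfect code. A subset $C$ of a group $G$ is an $(a,b)$-regular set (resp. perfect code, total perfect code) of $G$ if it is an $(a,b)$-regular set (resp. perfect code, total perfect code) in some Cayley graph of $G$. *)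

(* Defs.v *)
From HB Require Import structures.
From mathcomp Require Import all_boot all_fingroup.

Set Implicit Arguments.
Unset Strict Implicit.
Unset Printing Implicit Defensive.

Local Open Scope group_scope.

(* A graph is given by a vertex set V in an ambient finite type and an
   adjacency relation e, which only matters on V. *)
Definition regular_set (T : finType) (V : {set T}) (e : rel T) (a b : nat)
    (C : {set T}) : Prop :=
  [/\ C != set0,
      C \proper V,
      forall x, x \in C -> #|[set y in C | e x y]| = a
    & forall x, x \in V :\: C -> #|[set y in C | e x y]| = b].

Definition connection_set (gT : finGroupType) (G : {group gT}) (S : {set gT}) :
    Prop :=
  S \subset G :\ 1 /\ (forall x, x \in S -> x^-1 \in S).

(* Cay(G, S) has vertex set G and this adjacency relation. *)
Definition cayley_rel (gT : finGroupType) (S : {set gT}) : rel gT :=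
  [rel x y | y * x^-1 \in S].

Definition group_regular_set (gT : finGroupType) (G : {group gT}) (a b : nat)
    (C : {set gT}) : Prop :=
  exists2 S : {set gT}, connection_set G S &
    regular_set G (cayley_rel S) a b C.

Definition group_perfect_code (gT : finGroupType) (G : {group gT})
    (C : {set gT}) : Prop := group_regular_set G 0 1 C.

Definition group_total_perfect_code (gT : finGroupType) (G : {group gT})
    (C : {set gT}) : Prop := group_regular_set G 1 1 C.

(* Main.v *)
(** An inverse-closed set S of nontrivial elements makes H an (a, b)-regular set
    exactly when S meets H in a elements and every other right coset of H in b
    elements. Record such an S by the symmetric matrix c u v = #|S :&: u :&: v^-1|
    over pairs of right cosets. The cell u :&: v^-1 is empty unless HuH and HvH
    are mutually inverse, in which case it has m elements, where m n = #|H| and n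
    is the number of right cosets in HuH. Numbering these cosets by 0, ..., n-1,
    a Hankel matrix c u v = g ((i u + i v + s) mod n), with 0 <= g <= m and g
    summing to b, has all row sums equal to b. The only obstruction is on the
    diagonal: an odd entry c u u requires an involution in u. If m is odd, there
    is one because u :&: u^-1 has odd size; if n is odd, the given perfect code
    provides one; if both are even, s can be chosen so that the diagonal is even. *)

Require Import Defs.
From HB Require Import structures.
From mathcomp Require Import all_boot all_fingroup.
From mathcomp Require Import cyclic zify.

Set Implicit Arguments.
Unset Strict Implicit.
Unset Printing Implicit Defensive.

Local Open Scope group_scope.

(** * Inverse-closed sets and subsets of prescribed size *)

Lemma subset_of_card (T : finType) (A : {set T}) c :
  c <= #|A| -> exists2 B : {set T}, B \subset A & #|B| = c.
Proof.
rewrite -bin_gt0 -cards_draws card_gt0 => /set0Pn[B].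
by rewrite inE => /andP[? /eqP]; exists B.
Qed.

Section InverseClosed.

Variable gT : finGroupType.
Implicit Types (A B : {set gT}) (x z : gT).

Lemma inv_closed_mem A x : A^-1 = A -> (x^-1 \in A) = (x \in A).
Proof. by move=> AV; rewrite -mem_invg AV. Qed.

Lemma inv_closed_remove_pair A z :
    A^-1 = A -> z \in A -> z^-1 != z ->
  (A :\: [set z; z^-1])^-1 = A :\: [set z; z^-1] /\
  #|A| = #|A :\: [set z; z^-1]|.+2.
Proof.
move=> AV Az z'z; split.
  apply/setP=> x; rewrite mem_invg !inE inv_closed_mem //.
  by rewrite eqg_inv eqg_invLR (orbC (x == z^-1)).
have sA: [set z; z^-1] \subset A.
  by rewrite subUset !sub1set Az inv_closed_mem.
by rewrite -(cardsID [set z; z^-1] A) (setIidPr sA) cards2 eq_sym z'z.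
Qed.

(** Deleting a pair of distinct elements [z], [z^-1] keeps the parity, so such pairs cannot exhaust
    [A]. *)
Lemma odd_inv_closed_fixed A :
  A^-1 = A -> odd #|A| -> exists2 z, z \in A & z^-1 = z.
Proof.
have [k] := ubnP #|A|; elim: k A => // k IHk A leAk AV oddA.
have /set0Pn[z Az]: A != set0 by apply: contraTneq oddA => ->; rewrite cards0.
have [|z'z] := eqVneq z^-1 z; first by exists z.
have [AzV cardA] := inv_closed_remove_pair AV Az z'z.
have [|||t /setDP[]] := IHk (A :\: [set z; z^-1]) => //; last by exists t.
  by lia.
by move: oddA; rewrite cardA /= negbK.
Qed.

(** Pairs [z], [z^-1] are put into [B] while at least two elements are missing. If no such pair is
    left, every subset is inverse-closed; a remainder of 1 is filled by a fixed element. *)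
Lemma inv_closed_subset_card A c :
    A^-1 = A -> c <= #|A| -> (odd c -> exists2 z, z \in A & z^-1 = z) ->
  exists B : {set gT}, [/\ B \subset A, B^-1 = B & #|B| = c].
Proof.
elim/ltn_ind: c A => c IHc A AV leAc fixA.
have [/existsP[z /andP[Az z'z]] | noz] := boolP [exists z in A, z^-1 != z]; last first.
  have [B sBA cB] := subset_of_card leAc.
  exists B; split=> //; apply/setP=> x; rewrite mem_invg.
  have fixed y : y \in A -> y^-1 = y.
    by move=> Ay; apply/eqP; apply: contraNT noz => y'y; apply/existsP; exists y; rewrite Ay.
  have [Ax|nAx] := boolP (x \in A); first by rewrite fixed.
  rewrite (contraNF (subsetP sBA x) nAx) (contraNF (subsetP sBA x^-1)) //.
  by rewrite inv_closed_mem.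
case: c IHc leAc fixA => [|[|c]] IHc leAc fixA.
- by exists set0; rewrite sub0set cards0; split=> //; apply/setP=> x; rewrite mem_invg !inE.
- have [//|t At tV] := fixA; exists [set t]; rewrite sub1set cards1; split=> //.
  by rewrite invg_set1 tV.
have [AzV cardA] := inv_closed_remove_pair AV Az z'z.
have [||||B [sBA BV cB]] := IHc c _ (A :\: [set z; z^-1]) => //; first by lia.
- move=> oddc; have [|t At tV] := fixA; first by rewrite /= negbK.
  exists t => //; rewrite !inE At andbT; apply/norP; split.
    by apply: contraNneq z'z => <-; rewrite tV.
  by apply: contraNneq z'z => tz; rewrite -tz -tV tz invgK.
exists (B :|: [set z; z^-1]); split.
- rewrite subUset (subset_trans sBA) ?subsetDl //=.
  by rewrite subUset !sub1set Az inv_closed_mem.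
- apply/setP=> x; rewrite mem_invg !inE inv_closed_mem //.
  by rewrite eqg_inv eqg_invLR [in LHS](orbC (x == _)).
rewrite cardsU cards2 eq_sym z'z cB disjoint_setI0 ?cards0; first lia.
by rewrite disjoints_subset (subset_trans sBA) // setDE subsetIr.
Qed.

(* The sets u :&: v^-1 and v :&: u^-1 are exchanged by inversion, so only the
   diagonal ones constrain the prescribed intersection sizes c u v. *)
Lemma inv_closed_select (P : {set {set gT}}) A (c : {set gT} -> {set gT} -> nat) :
    A^-1 = A -> {in P &, forall u v, c u v = c v u} ->
    {in P &, forall u v, c u v <= #|A :&: (u :&: v^-1)|} ->
    {in P, forall u, odd (c u u) ->
       exists2 z, z \in A :&: (u :&: u^-1) & z^-1 = z} ->
    trivIset P ->
  exists S : {set gT}, [/\ S \subset A, S^-1 = S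
    & {in P &, forall u v, #|S :&: (u :&: v^-1)| = c u v}].
Proof.
move=> AV cC leC fixC tiP.
pose cell u v := A :&: (u :&: v^-1).
have cellV u v : (cell u v)^-1 = cell v u.
  by apply/setP=> x; rewrite !inE inv_closed_mem // invgK andbCA [(x \in v) && _]andbC andbCA.
have pick (uv : {set gT} * {set gT}) : exists B : {set gT},
    uv.1 \in P -> uv.2 \in P ->
  [/\ B \subset cell uv.1 uv.2, (uv.1 = uv.2 -> B^-1 = B) & #|B| = c uv.1 uv.2].
  case: uv => u v /=; have [/andP[Pu Pv]|] := boolP ((u \in P) && (v \in P)); last first.
    by move=> nP; exists set0 => Pu Pv; rewrite Pu Pv in nP.
  have [euv | neuv] := eqVneq u v.
    subst v; have [B [sB BV cB]] := inv_closed_subset_card (cellV u u) (leC u u Pu Pu) (fixC u Pu).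
    by exists B.
  have [B sB cB] := subset_of_card (leC u v Pu Pv).
  exists B => _ _; split=> // euv.
  by rewrite euv eqxx in neuv.
have [F0 F0P] := fin_all_exists pick.
(* Of the two cells for [(u, v)] and [(v, u)], only the one in rank order keeps its own choice; the
   other receives the inverse set, which makes the union inverse-closed. *)
pose F u v := if enum_rank u <= enum_rank v then F0 (u, v) else (F0 (v, u))^-1.
have FP : {in P &, forall u v, [/\ F u v \subset cell u v, (F u v)^-1 = F v u & #|F u v| = c u v]}.
  move=> u v Pu Pv; rewrite /F.
  have [s1 V1 c1] := F0P (u, v) Pu Pv; have [s2 V2 c2] := F0P (v, u) Pv Pu.
  case: ltngtP => [luv|lvu|/val_inj/enum_rank_inj euv] /=.
  - by split.
  - by rewrite invgK card_invg c2 (cC u v) // -cellV invSg.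
  - by subst v; split=> //; apply: V1.
have inP u v x : u \in P -> v \in P -> x \in u -> x \in v -> u = v.
  move=> Pu Pv ux vx; apply/eqP; apply: contraT => neuv.
  by have /(trivIsetP tiP _ _ Pu Pv)/disjointFr/(_ ux) := neuv; rewrite vx.
pose S := \bigcup_(uv in setX P P) F uv.1 uv.2.
have SP x : reflect (exists u v, [/\ u \in P, v \in P & x \in F u v]) (x \in S).
  apply: (iffP bigcupP) => [[[u v]]|[u [v [Pu Pv Fx]]]].
    by rewrite inE /= => /andP[Pu Pv] Fx; exists u, v.
  by exists (u, v); rewrite // inE /= Pu.
have SV x : x \in S -> x^-1 \in S.
  case/SP=> u [v [Pu Pv Fx]]; apply/SP; exists v, u; split=> //.
  by have [_ <- _] := FP u v Pu Pv; rewrite mem_invg invgK.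
exists S; split.
- apply/subsetP=> x /SP[u [v [Pu Pv Fx]]].
  by have [/subsetP/(_ x Fx)/setIP[]] := FP u v Pu Pv.
- by apply/setP=> x; rewrite mem_invg; apply/idP/idP => /SV //; rewrite invgK.
move=> u v Pu Pv; have [sF _ <-] := FP u v Pu Pv; congr #|pred_of_set _|.
apply/setP=> x; apply/setIP/idP=> [[/SP[u' [v' [Pu' Pv' Fx]]] /setIP[ux vx]]|Fx].
  have [/subsetP/(_ x Fx)/setIP[_ /setIP[ux' vx']] _ _] := FP u' v' Pu' Pv'.
  rewrite (inP u u' x) // (inP v v' x^-1) //; by rewrite -mem_invg.
split; first by apply/SP; exists u, v.
by have /setIP[] := subsetP sF x Fx.
Qed.

End InverseClosed.

(** * Greedy filling of bins and cyclic shifts *)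

Lemma sum_greedy_fill n m b : \sum_(j < n) minn m (b - m * j) = minn b (m * n).
Proof.
elim: n => [|n IHn]; first by rewrite big_ord0 muln0 minn0.
by rewrite big_ord_recr /= IHn mulnS; lia.
Qed.

Lemma sum_rot_modn n k (g : nat -> nat) :
  \sum_(j < n) g ((k + j) %% n) = \sum_(j < n) g j.
Proof.
case: n => [|n]; first by rewrite !big_ord0.
pose rot (j : 'I_n.+1) : 'I_n.+1 := Ordinal (ltn_pmod (k + j) (ltn0Sn n)).
rewrite [RHS](reindex_inj (h := rot)) // => i j /(congr1 val)/= /eqP.
by rewrite eqn_modDl !modn_small // => /eqP/val_inj.
Qed.

Lemma sum_index_enum (T : finType) (C : {set T}) (g : nat -> nat) :
  \sum_(v in C) g (index v (enum C)) = \sum_(j < #|C|) g j.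
Proof.
rewrite big_enum_val; apply: eq_bigr => i _; congr g.
by rewrite (enum_val_nth (enum_val i)) index_uniq ?enum_uniq // -cardE.
Qed.

(** Filling bins of capacity [m] in order gives full bins, then at most one partial bin, then empty
    ones. For even [m] only the partial bin, number [b %/ m], can hold an odd amount. *)
Lemma odd_greedy_fill m b j :
  ~~ odd m -> odd (minn m (b - m * j)) -> j = b %/ m.
Proof.
move=> evm oddg.
have m_gt0 : 0 < m by case: (m) oddg => //; rewrite min0n.
have [lt1 lt2] : m * j < b /\ b < m * j + m.
  move: oddg evm; rewrite /minn; case: ltnP => [_ ->|] //; move=> h1 h2; split; last lia.
  by rewrite -subn_gt0; case: (b - _) h2.
by rewrite -(subnKC (ltnW lt1)) mulnC divnMDl // divn_small ?addn0 //; lia.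
Qed.

(** Modulo [n] the equation says [2 i = 1], which is impossible for even [n]. *)
Lemma odd_shift_fixed n i j : (i + i + (j + n.-1)) %% n = j -> 0 < n -> odd n.
Proof.
move=> eqj n_gt0; have := divn_eq (i + i + (j + n.-1)) n; rewrite eqj => eqn.
have /(congr1 odd) : (i + i + n = (i + i + (j + n.-1)) %/ n * n + 1)%N by lia.
by rewrite !oddD addbb oddM addbT /=; case: (odd n); rewrite ?andbF.
Qed.

Lemma card_sum_fibre (T U : finType) (A : {set T}) (P : {set U}) (f : T -> U) :
    {in A, forall x, f x \in P} ->
  #|A| = \sum_(v in P) #|[set x in A | f x == v]|.
Proof.
move=> fP; rewrite -sum1_card (partition_big f (mem P)) //=.
by apply: eq_bigr => v _; rewrite -sum1_card; apply: eq_bigl => x; rewrite inE.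
Qed.

(** * Double cosets of [H] and the cells [u :&: v^-1] *)

Section DoubleCosets.

Variables (gT : finGroupType) (G H : {group gT}).
Hypothesis sHG : H \subset G.
Implicit Types (A S u v w : {set gT}) (x y z : gT).

Lemma dcosetV x : (H :* x * H)^-1 = H :* x^-1 * H.
Proof. by rewrite !invMg invg_set1 !invGid mulgA. Qed.

Lemma dcoset_refl x : x \in H :* x * H.
Proof. by apply/mulsgP; exists x 1; rewrite ?rcoset_refl ?group1 ?mulg1. Qed.

Lemma rcosets_dcoset x v :
  x \in G -> (v \in rcosets H (H :* x * H)) = (v \in rcosets H G) && (v * H == H :* x * H).
Proof.
move=> Gx; apply/idP/andP=> [/rcosetsP[z] | [/rcosetsP[z Gz ->] /eqP eqD]].
  case/mulsgP=> _ k /rcosetP[h Hh ->] Hk -> ->; split.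
    by apply/rcosetsP; exists (h * x * k); rewrite ?groupM // (subsetP sHG).
  by rewrite !rcosetM (rcoset_id Hh) -mulgA lcoset_id.
by apply/rcosetsP; exists z; rewrite // -eqD dcoset_refl.
Qed.

Lemma card_setI_dcoset A x :
  x \in G -> #|A :&: (H :* x * H)| = \sum_(v in rcosets H (H :* x * H)) #|A :&: v|.
Proof.
move=> Gx; rewrite (@card_sum_fibre _ _ _ (rcosets H (H :* x * H)) (fun z => H :* z)).
  apply: eq_bigr => v; rewrite rcosets_dcoset // => /andP[/rcosetsP[y Gy ->] /eqP eqD].
  congr #|pred_of_set _|; apply/setP=> z; rewrite !inE -andbA; congr (_ && _).
  apply/andP/idP=> [[_ /eqP<-] | yz]; first exact: rcoset_refl.
  have -> : H :* z = H :* y by apply/rcoset_eqP.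
  by rewrite -eqD; split=> //; apply/mulsgP; exists z 1; rewrite ?mulg1.
by move=> z /setIP[_ Dz]; apply/rcosetsP; exists z.
Qed.

Lemma card_rcosets_dcoset x :
  x \in G -> (#|rcosets H (H :* x * H)| * #|H|)%N = #|H :* x * H|.
Proof.
move=> Gx; rewrite -[H :* x * H in RHS]setTI card_setI_dcoset // -sum_nat_const.
by apply: eq_bigr => _ /rcosetsP[z _ ->]; rewrite setTI card_rcoset.
Qed.

(** With [u = H :* x], the cell is a left translate of [H :^ x :&: H]. Its size follows from the
    product formula, as [H :^ x * H] is a left translate of [H :* x * H]. *)
Lemma card_rcosetI_inv u v :
    u \in rcosets H G -> v \in rcosets H G -> u * H = (v * H)^-1 ->
  (#|u :&: v^-1| * #|rcosets H (u * H)|)%N = #|H|.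
Proof.
case/rcosetsP=> x Gx -> /rcosetsP[y Gy ->] eqD.
have /mulsgP[_ k /rcosetP[h Hh ->] Hk y'E] : y^-1 \in H :* x * H.
  by rewrite eqD mem_invg invgK dcoset_refl.
have -> : H :* x :&: (H :* y)^-1 = (h * x) *: (H :^ x :&: H).
  apply/setP=> z; rewrite mem_lcoset in_setI mem_invg 2!mem_rcoset in_setI mem_conjg.
  congr (_ && _); last first.
    by rewrite y'E mulgA (groupMr _ Hk) -groupV invMg invgK.
  by rewrite conjgE invgK invMg !mulgA mulgV mul1g -mulgA [RHS]groupMl ?groupV.
have eqc : #|H :* x * H| = #|H :^ x * H|.
  rewrite -(card_lcoset (H :^ x * H) x); congr #|pred_of_set _|.
  by rewrite mulgA conjsgE -lcosetM mulgV mul1g.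
have := mul_cardG (H :^ x) H.
rewrite card_lcoset cardJg -eqc -card_rcosets_dcoset // [RHS]mulnC mulnA => /eqP.
by rewrite eqn_pmul2r ?cardG_gt0 // => /eqP ->.
Qed.

Lemma dcoset_eq_group u : u \in rcosets H G -> (u * H == H) = (u == H).
Proof.
case/rcosetsP=> x Gx ->; apply/eqP/eqP=> [eqH | ->]; last exact: mulGid.
by apply/rcoset_id; rewrite -eqH dcoset_refl.
Qed.

(* A transversal meeting the self-inverse double coset HxH in an odd number of
   elements fixes one of them under inversion; conjugation by H then moves this
   involution into any prescribed coset of HxH. *)
Lemma odd_dcoset_involution S u :
    S^-1 = S -> {in rcosets H G, forall w, w != H -> #|S :&: w| = 1%N} ->
    u \in rcosets H G -> u != H -> u * H = (u * H)^-1 ->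
    odd #|rcosets H (u * H)| ->
  exists2 z, z \in u :&: u^-1 & z^-1 = z.
Proof.
move=> SV S1 Xu ntu DV oddn.
have /rcosetsP[x Gx def_u] := Xu.
have cardSD : #|S :&: (u * H)| = #|rcosets H (u * H)|.
  rewrite def_u card_setI_dcoset // -sum1_card; apply: eq_bigr => w.
  rewrite rcosets_dcoset // -def_u => /andP[Xw /eqP eqD].
  by rewrite S1 // -dcoset_eq_group // eqD dcoset_eq_group.
have SDV : (S :&: (u * H))^-1 = S :&: (u * H) by rewrite invIg SV -DV.
have [|t /setIP[_ /mulsgP[y k uy Hk def_t]] tV] := odd_inv_closed_fixed SDV.
  by rewrite cardSD.
have tJV : (t ^ k^-1)^-1 = t ^ k^-1 by rewrite -conjVg tV.
have ut : t ^ k^-1 \in u.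
  rewrite conjgE invgK def_t -!mulgA mulgV mulg1 def_u.
  by move: uy; rewrite def_u !mem_rcoset -mulgA; apply: groupM.
by exists (t ^ k^-1) => //; rewrite inE ut mem_invg tJV.
Qed.

(** * Regularity of [H] in terms of intersections with right cosets *)

Lemma regular_neighbours S x :
  #|[set y in H | cayley_rel S x y]| = #|S :&: (H :* x^-1)|.
Proof.
rewrite -(card_rcoset [set y in H | cayley_rel S x y] x^-1); congr #|pred_of_set _|.
by apply/setP=> z; rewrite mem_rcoset !inE mem_rcoset invgK /cayley_rel /= mulgK andbC.
Qed.

(** Right translation by [x^-1] carries the neighbours of [x] in [H] onto [S :&: H :* x^-1], and
    this coset is [H] exactly when [x] lies in [H]. *)
Lemma group_regular_setP a b :
  group_regular_set G a b H <->
  H \proper G /\ exists S, [/\ S \subset G :\ 1, S^-1 = S, #|S :&: H| = a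
    & {in rcosets H G, forall u, u != H -> #|S :&: u| = b}].
Proof.
split=> [[S [sSG SV] [_ prH Sa Sb]] | [prH [S [sSG SV Sa Sb]]]].
  split=> //; exists S; split=> //.
  - apply/setP=> x; rewrite mem_invg.
    by apply/idP/idP => /SV //; rewrite invgK.
  - by have := Sa 1 (group1 H); rewrite regular_neighbours invg1 mulg1.
  - move=> _ /rcosetsP[x Gx ->] ntx.
    rewrite -(Sb x^-1) ?regular_neighbours ?invgK //.
    rewrite inE !groupV Gx andbT; apply: contraNN ntx => Hx.
    by rewrite rcoset_id.
exists S; first by split=> // x Sx; rewrite inv_closed_mem.
split=> //; first by apply/set0Pn; exists 1; apply: group1.
  by move=> x Hx; rewrite regular_neighbours rcoset_id ?groupV.
move=> x /setDP[Gx nHx]; rewrite regular_neighbours Sb //.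
  by apply/rcosetsP; exists x^-1; rewrite ?groupV.
by apply: contraNneq nHx => eqH; rewrite -groupV -eqH rcoset_refl.
Qed.


(** Leaving [a0] free covers perfect codes ([a0 = 0]) and total perfect codes ([a0 = 1]) at once. *)
Lemma regular_set_of_perfect_code a0 a b :
    group_regular_set G a0 1 H ->
    a <= #|H| - 1 -> b <= #|H| -> (odd #|H| -> ~~ odd a) ->
  group_regular_set G a b H.
Proof.
case/group_regular_setP=> prH [S1 [_ S1V _ S1t]] le_a le_b ev_a.
apply/group_regular_setP; split=> //.
pose n u := #|rcosets H (u * H)|.
pose m u := #|H| %/ n u.
pose idx u := index u (enum (rcosets H (u * H))).
(* The shift b %/ m + n - 1 puts the only partially filled residue, b %/ m, at
   index sum 1, which no diagonal entry hits when n is even: when m is even, an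
   odd diagonal entry thus forces n to be odd. *)
pose fill u k := minn (m u) (b - m u * ((k + (b %/ m u + (n u).-1)) %% n u)).
(* The pair [(H, H)] gets [a], other pairs with mutually inverse double cosets get Hankel entries,
   and the remaining cells are empty. *)
pose c u v := if u * H == (v * H)^-1 then
    if u * H == H :> {set gT} then a else fill u (idx u + idx v)
  else 0.
have XV u v : u \in rcosets H G -> v \in rcosets H G -> u * H = (v * H)^-1 -> n u = n v.
  case/rcosetsP=> x Gx -> /rcosetsP[y Gy ->] /(congr1 (fun A : {set gT} => #|A|)).
  rewrite card_invg -!card_rcosets_dcoset // => /eqP.
  by rewrite eqn_pmul2r ?cardG_gt0 // => /eqP.
have n_gt0 u : u \in rcosets H G -> 0 < n u.
  case/rcosetsP=> x Gx ->; rewrite card_gt0; apply/set0Pn; exists (H :* x).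
  by apply/rcosetsP; exists x; rewrite ?dcoset_refl.
have mE u v : u \in rcosets H G -> v \in rcosets H G -> u * H = (v * H)^-1 ->
    #|u :&: v^-1| = m u.
  by move=> Xu Xv D; rewrite /m -(card_rcosetI_inv Xu Xv D) mulnK ?n_gt0.
have mnE u : u \in rcosets H G -> (m u * n u)%N = #|H|.
  move=> Xu; have /rcosetsP[x Gx def_u] := Xu.
  have Xv : H :* x^-1 \in rcosets H G by apply/rcosetsP; exists x^-1; rewrite ?groupV.
  have D : u * H = (H :* x^-1 * H)^-1 by rewrite def_u dcosetV invgK.
  by rewrite -(mE _ _ Xu Xv D) card_rcosetI_inv.
have AV : (G :\ 1)^-1 = G :\ 1.
  by apply/setP=> x; rewrite mem_invg !inE groupV invg_eq1.
have HA : (G :\ 1) :&: (H :&: H^-1) = H :\ 1.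
  by rewrite invGid setIid setIDAC (setIidPr sHG).
have HAV : (H :\ 1)^-1 = H :\ 1.
  by apply/setP=> x; rewrite mem_invg !inE groupV invg_eq1.
have cardH1 : #|H :\ 1| = (#|H| - 1)%N by rewrite (cardsD1 1 H) group1 addKn.
have cellE u v : u \in rcosets H G -> u != H -> (G :\ 1) :&: (u :&: v^-1) = u :&: v^-1.
  move=> Xu ntu; apply/setIidPr/subsetP=> x /setIP[ux _].
  have /rcosetsP[y Gy def_u] := Xu; rewrite !inE; apply/andP; split.
    apply: contraNneq ntu => x1; rewrite def_u; apply/eqP/rcoset_id.
    by move: ux; rewrite x1 def_u mem_rcoset mul1g groupV.
  by move: ux; rewrite def_u => /rcosetP[h Hh ->]; rewrite groupM // (subsetP sHG).
have dcosetH u v : u \in rcosets H G -> v \in rcosets H G -> u * H = (v * H)^-1 ->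
    u = H -> v = H.
  move=> Xu Xv D uH; apply/eqP; rewrite -dcoset_eq_group //.
  by rewrite -[v * H]invgK -D uH mulGid invGid.
have [||||S [sS SV ScE]] := @inv_closed_select _ (rcosets H G) (G :\ 1) c AV.
- move=> u v Xu Xv; rewrite /c [v * H == _]eq_sym -eqg_invLR.
  case: eqP => // D; rewrite !dcoset_eq_group //.
  have D' : u * H = (v * H)^-1 by rewrite -D invgK.
  have -> : (v == H) = (u == H) by apply/eqP/eqP; apply: dcosetH.
  by rewrite /fill /m (XV u v) // (addnC (idx u)).
- move=> u v Xu Xv; rewrite /c; case: eqP => // D; rewrite dcoset_eq_group //.
  case: eqP => [uH | /eqP ntu]; last by rewrite cellE // mE // geq_minl.
  by rewrite (dcosetH u v) // uH HA cardH1.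
- move=> u Xu; rewrite /c; case: eqP => // D; rewrite dcoset_eq_group //.
  (* An odd [a] forces [#|H|] to be even, so [H :\ 1] has odd size and contains an involution. *)
  case: eqP => [-> odd_a | /eqP ntu odd_c].
    rewrite HA; apply: odd_inv_closed_fixed; rewrite // cardH1.
    have evH : ~~ odd #|H| by apply/negP => /ev_a; rewrite odd_a.
    by rewrite oddB ?cardG_gt0 // (negPf evH).
  rewrite cellE //; have uV : (u :&: u^-1)^-1 = u :&: u^-1 by rewrite invIg invgK setIC.
  have [oddm | evm] := boolP (odd (m u)).
    by apply: odd_inv_closed_fixed; rewrite // mE.
  have eqj := odd_greedy_fill evm odd_c.
  apply: (@odd_dcoset_involution S1) => //.
  exact: odd_shift_fixed eqj (n_gt0 u Xu).
- by case/and3P: (rcosets_partition sHG).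
exists S; split=> //.
  have XH : (H : {set gT}) \in rcosets H G by apply/rcosetsP; exists 1; rewrite ?rcoset1.
  by have := ScE H H XH XH; rewrite /c mulGid invGid eqxx setIid.
move=> u Xu ntu; have /rcosetsP[x Gx def_u] := Xu.
(* The fibre over [v] is the part of [S :&: u] inside [v^-1], so the size becomes the sum of row [u]
   of [c]. *)
rewrite (@card_sum_fibre _ _ _ (rcosets H G) (fun z => H :* z^-1)); last first.
  move=> z /setIP[/(subsetP sS)/setD1P[_ Gz] _]; apply/rcosetsP.
  by exists z^-1; rewrite ?groupV.
have Gx' : x^-1 \in G by rewrite groupV.
(* Only cosets [v] in the double coset inverse to [u * H] contribute. *)
transitivity (\sum_(v in rcosets H (H :* x^-1 * H)) fill u (idx u + idx v)).
  rewrite (eq_bigl _ _ (fun v => rcosets_dcoset v Gx')) big_mkcondr.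
  apply: eq_bigr => v Xv; rewrite -dcosetV -def_u eq_sym eqg_invLR.
  have := ScE u v Xu Xv; rewrite /c dcoset_eq_group // (negPf ntu) => <-.
  congr #|pred_of_set _|; apply/setP=> z; rewrite !inE -andbA; congr (_ && (_ && _)).
  have /rcosetsP[y Gy ->] := Xv.
  by rewrite rcoset_sym; apply/eqP/rcoset_eqP => //.
have cardC : #|rcosets H (H :* x^-1 * H)| = n u.
  apply/eqP; rewrite -(eqn_pmul2r (cardG_gt0 H)) card_rcosets_dcoset //.
  by rewrite -dcosetV card_invg /n def_u card_rcosets_dcoset.
(* The row is a rotation of the greedy filling of [n u] bins of capacity [m u]; their total capacity
   [#|H|] is at least [b], so everything fits. *)
rewrite -[RHS](minn_idPl le_b) -(mnE u Xu) -sum_greedy_fill.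
pose k := (idx u + (b %/ m u + (n u).-1))%N.
pose g j := minn (m u) (b - m u * j).
rewrite -(sum_rot_modn _ k g) -cardC.
rewrite -(sum_index_enum (rcosets H (H :* x^-1 * H)) (fun j => g ((k + j) %% _))).
apply: eq_bigr => v; rewrite rcosets_dcoset // => /andP[_ /eqP eqD].
by rewrite /fill /idx eqD cardC addnAC.
Qed.

End DoubleCosets.

Lemma fixed_inv_even_card (gT : finGroupType) (H : {group gT}) (t : gT) :
  t \in H -> t != 1 -> t^-1 = t -> ~~ odd #|H|.
Proof.
move=> Ht nt_t tV; have t2 : t ^+ 2 = 1 by rewrite expgS expg1 -{1}tV mulVg.
apply: contra nt_t => oddH; have := expg_cardG Ht.
by rewrite -(odd_double_half #|H|) oddH expgS -mul2n expgM t2 expg1n mulg1 => ->.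
Qed.

Theorem theorem1p3 (gT : finGroupType) (G H : {group gT}) (p q : nat)
    (p_prime : prime p) (q_prime : prime q)
    (oG : #|G| = (4 * p)%N \/ #|G| = (p * q)%N)
    (sHG : H \subset G) (ntH : H :!=: 1%g) :
  (group_perfect_code G H <->
     (forall a b : nat, (a <= #|H| - 1)%N -> (b <= #|H|)%N ->
        (odd #|H| -> ~~ odd a) -> group_regular_set G a b H))
  /\
  (group_total_perfect_code G H <->
     (forall a b : nat, (a <= #|H| - 1)%N -> (b <= #|H|)%N ->
        group_regular_set G a b H)).
Proof.
(* This makes [a = 1] an admissible value in (b). *)
have H_gt1 : 1 < #|H| by rewrite cardG_gt1.
split; split=> [codeH a b le_a le_b | regH].
- exact: (regular_set_of_perfect_code sHG codeH).
- by apply: regH => //; apply: ltnW.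
- apply: (regular_set_of_perfect_code sHG codeH) => // oddH.
  (* The single element of [S :&: H] is its own inverse, hence an involution of [H], which
     contradicts the odd order. *)
  case/group_regular_setP: codeH => _ [S [sS SV S1 _]].
  have [||t /setIP[St Ht] tV] := @odd_inv_closed_fixed _ (S :&: H).
  + by rewrite invIg SV invGid.
  + by rewrite S1.
  have /setD1P[nt_t _] := subsetP sS t St.
  by have := fixed_inv_even_card Ht nt_t tV; rewrite oddH.
- by apply: regH; [lia | apply: ltnW].
Qed.
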